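(* Let $R$ be a ring and $S$ a multiplicatively closed subset of $R$. If there is an $S$-$1$-absorbing primary ideal of $R$ which is not an $S$-primary ideal of $R$, then $R$ is a quasilocal ring.
   Context: All rings are commutative with non-zero identity. A ring is quasilocal if it has exactly one maximal ideal. A proper ideal $I$ of $R$ with $I\cap S=\emptyset$ is called $S$-$1$-absorbing primary if there exists a fixed $s\in S$ such that for all non-unit $a,b,c\in R$, if $abc\in I$, then $sab\in I$ or $sc\in\sqrt{I}$. An ideal $I$ of $R$ with $I\cap S=\emptyset$ is called $S$-primary if there exists a fixed $s\in S$ such that for all $a,b\in R$, if $ab\in I$, then $sa\in\sqrt{I}$ or $sb\in I$. *)

(* Defs.v *)
From mathcomp Require Import all_boot all_algebra.
From mathcomp Require Import boolp classical_sets.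

Set Implicit Arguments.
Unset Strict Implicit.
Unset Printing Implicit Defensive.

Import GRing.Theory.
Local Open Scope classical_set_scope.
Local Open Scope ring_scope.

(* [GRing.unit] needs a [unitRingType]; an arbitrary commutative ring with
   1 <> 0 is only a [comNzRingType]. *)
Definition invertible (R : comNzRingType) (x : R) : Prop :=
  exists y : R, x * y = 1.

(* [idealr_closed] includes [1 \notin I]. An ideal disjoint from a set [S]
   with [1 \in S] is always proper, so nothing is lost where properness is
   not explicitly asked for. *)
Definition proper_ideal_set (R : comNzRingType) (I : set R) : Prop :=
  idealr_closed [in I].

Definition mult_closed_set (R : comNzRingType) (S : set R) : Prop :=
  GRing.mulr_closed [in S].

Definition radical (R : comNzRingType) (I : set R) : set R :=
  [set x | exists2 n : nat, (0 < n)%N & x ^+ n \in I].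

Definition maximal_ideal (R : comNzRingType) (M : set R) : Prop :=
  proper_ideal_set M /\
  forall J : set R, proper_ideal_set J -> M `<=` J -> J = M.

Definition quasilocal (R : comNzRingType) : Prop :=
  exists! M : set R, maximal_ideal M.

Definition S_one_absorbing_primary (R : comNzRingType) (S I : set R) : Prop :=
  [/\ proper_ideal_set I, I `&` S = set0 &
    exists2 s : R, s \in S &
      forall a b c : R, ~ invertible a -> ~ invertible b -> ~ invertible c ->
        a * b * c \in I -> s * a * b \in I \/ s * c \in radical I].

Definition S_primary (R : comNzRingType) (S I : set R) : Prop :=
  [/\ proper_ideal_set I, I `&` S = set0 &
    exists2 s : R, s \in S &
      forall a b : R, a * b \in I -> s * a \in radical I \/ s * b \in I].

(* Main.v *)
Require Import Defs.
From mathcomp Require Import all_boot all_algebra.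
From mathcomp Require Import boolp classical_sets.

(** The heart of the matter is that a ring is quasilocal as soon as some ideal
    [I] and some [x] outside [I] satisfy [c * x \in I] for every non-unit [c]
    ([quasilocal_of_nonunits_mul_in]): modulo [I], the nonzero class of [x] is
    annihilated by all non-units, hence by their sums, and a unit cannot
    annihilate it.  So sums of non-units are non-units, and the non-units form
    the unique maximal ideal.

    Such an [x] comes from the failure of primariness.  Let [s] witness that
    [I] is S-1-absorbing primary.  As [I] is not S-primary, this same [s] is
    defeated by some [a], [b] with [a * b \in I], [s * a] outside the radical
    of [I] and [s * b] outside [I].  Neither [a] nor [b] is a unit, so for each
    non-unit [c] the 1-absorbing property applies to [c * b * a] and leaves
    only [s * c * b \in I].  Hence [x = s * b] works. *)

Set Implicit Arguments.
Unset Strict Implicit.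
Unset Printing Implicit Defensive.

Import GRing.Theory.
Local Open Scope classical_set_scope.
Local Open Scope ring_scope.

Section ProperIdeals.
Variables (R : comNzRingType) (I : set R).
Hypothesis idealI : proper_ideal_set I.

Lemma proper_ideal_add x y : x \in I -> y \in I -> x + y \in I.
Proof. by case: idealI => _ _ H xI yI; rewrite -[x]mul1r; apply: H. Qed.

Lemma proper_ideal_mull x y : y \in I -> x * y \in I.
Proof. by case: idealI => I0 _ H yI; rewrite -[x * y]addr0; apply: H. Qed.

Lemma proper_ideal_nonunit x : x \in I -> ~ invertible x.
Proof.
case: idealI => _ I1 _ xI [y xy]; move/negP: I1; apply.
by rewrite -xy mulrC; apply: proper_ideal_mull.
Qed.

Lemma mem_of_invertible_mul u x : invertible u -> u * x \in I -> x \in I.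
Proof.
case=> v uv uxI; rewrite -[x]mul1r -uv [u * v]mulrC -mulrA.
exact: proper_ideal_mull.
Qed.

Lemma mem_radical x : x \in I -> x \in radical I.
Proof. by move=> xI; rewrite in_setE; exists 1%N. Qed.

End ProperIdeals.

Lemma invertible_mulr (R : comNzRingType) (x y : R) :
  invertible (x * y) -> invertible y.
Proof. by case=> z xyz; exists (x * z); rewrite mulrCA mulrA. Qed.

(** The non-units always absorb multiplication and contain every proper ideal,
    so additive closure alone makes them the largest proper ideal. *)
Lemma quasilocal_of_nonunits_add (R : comNzRingType) :
  (forall c d : R, ~ invertible c -> ~ invertible d -> ~ invertible (c + d)) ->
  quasilocal R.
Proof.
move=> nonunitD; pose M : set R := [set x | ~ invertible x].
have idealM : proper_ideal_set M.
  split=> [||a u v].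
  - by rewrite in_setE => -[y /eqP]; rewrite mul0r eq_sym oner_eq0.
  - by apply/negP; rewrite in_setE; apply; exists 1; rewrite mulr1.
  - rewrite !in_setE => uM vM; apply: nonunitD vM.
    by move/invertible_mulr.
have leM (J : set R) : proper_ideal_set J -> J `<=` M.
  by move=> idJ x Jx; apply: (proper_ideal_nonunit idJ); rewrite in_setE.
exists M; split=> [|N [idN maxN]]; last by apply: maxN (leM _ idN).
by split=> // J idJ MJ; apply/seteqP; split=> //; apply: leM.
Qed.

(** If [c + d] were a unit, [(c + d) * x \in I] would put [x] in [I]. *)
Lemma quasilocal_of_nonunits_mul_in (R : comNzRingType) (I : set R) (x : R) :
  proper_ideal_set I -> x \notin I ->
  (forall c : R, ~ invertible c -> c * x \in I) -> quasilocal R.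
Proof.
move=> idI /negP xI nonunitI; apply: quasilocal_of_nonunits_add => c d nc nd ucd.
apply: xI; apply: (mem_of_invertible_mul idI ucd); rewrite mulrDl.
by apply: (proper_ideal_add idI); apply: nonunitI.
Qed.

Theorem theorem5 (R : comNzRingType) (S : set R) (hS : mult_closed_set S) :
  (exists I : set R, S_one_absorbing_primary S I /\ ~ S_primary S I) ->
  quasilocal R.
Proof.
move=> [I [[idI IS0 [s sS absI]] notprim]].
apply: contrapT => notqloc; apply: notprim; split=> //; exists s => // a b abI.
apply: contrapT => /not_orP[saI sbI].
have na : ~ invertible a.
  move=> ua; apply: sbI; apply: (proper_ideal_mull idI).
  exact: mem_of_invertible_mul abI.
have nb : ~ invertible b.
  move=> ub; apply: saI; apply: mem_radical; apply: (proper_ideal_mull idI).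
  by apply: mem_of_invertible_mul ub _ => //; rewrite mulrC.
apply: notqloc.
apply: (@quasilocal_of_nonunits_mul_in _ I (s * b)) => // [|c nc]; first exact/negP.
have cbaI : c * b * a \in I.
  by rewrite -mulrA [b * a]mulrC; apply: (proper_ideal_mull idI).
by case: (absI c b a nc nb na cbaI) => //; rewrite mulrA [c * s]mulrC.
Qed.
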